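(* Given real numbers $\lambda_1>0>\lambda_2\ge\lambda_3$, define $$a:=3\lambda_1\lambda_2\lambda_3,\qquad b:=2(\lambda_1\lambda_2+\lambda_1\lambda_3+\lambda_2\lambda_3),\qquad c:=\lambda_1+\lambda_2+\lambda_3,$$ and let $$\bar k_{\pm}:=\frac{-b\pm\sqrt{b^2-4ac}}{2a}$$ be the two solutions of the quadratic equation $$3\lambda_1\lambda_2\lambda_3\,\bar k^2+2(\lambda_1\lambda_2+\lambda_1\lambda_3+\lambda_2\lambda_3)\,\bar k+\lambda_1+\lambda_2+\lambda_3=0.$$ Then $$\bar k_-\in\left(-\frac1{\lambda_1},-\frac1{\lambda_3}\right)\quad\text{and}\quad\bar k_+\ge-\frac1{\lambda_3}.$$ *)

(* Defs.v *)
From Stdlib Require Import Reals.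

(* Main.v *)
Require Import Defs.
From Stdlib Require Import Reals.
From Stdlib Require Import Lra Psatz.
Open Scope R_scope.

(** The quadratic is the derivative of [(1 + l1 k) (1 + l2 k) (1 + l3 k)], so its
    values at [- (1 / l1)] and [- (1 / l3)] factor as
    [(l1 - l2) (l1 - l3) / l1 > 0] and [(l3 - l1) (l3 - l2) / l3 <= 0].
    With [D] the discriminant, [D - (2 a t + b)^2 = - 4 a p(t)] turns these signs
    into comparisons of [sqrt D] with [2 a t + b]. The only delicate case is
    [l2 = l3], where [- (1 / l3)] is itself a root; there [2 a t + b > 0] shows
    that it is the larger one. *)

(** Multiplying by [4 * a] completes the square, and the result splits as a difference of two
    squares. *)
Lemma quadratic_roots (a b c k : R) :
  0 < a -> 0 <= b ^ 2 - 4 * a * c ->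
  a * k ^ 2 + b * k + c = 0 <->
  k = (- b - sqrt (b ^ 2 - 4 * a * c)) / (2 * a) \/
  k = (- b + sqrt (b ^ 2 - 4 * a * c)) / (2 * a).
Proof.
  intros ha hD.
  pose proof (pow2_sqrt _ hD) as hs.
  set (s := sqrt (b ^ 2 - 4 * a * c)) in *.
  assert (hfac : 4 * a * (a * k ^ 2 + b * k + c)
                 = (2 * a * k + b + s) * (2 * a * k + b - s)).
  { replace ((2 * a * k + b + s) * (2 * a * k + b - s))
      with ((2 * a * k + b) ^ 2 - s ^ 2) by ring.
    rewrite hs; ring. }
  split.
  - intro hk; rewrite hk, Rmult_0_r in hfac.
    destruct (Rmult_integral _ _ (eq_sym hfac)) as [h | h]; [left | right];
      apply (Rmult_eq_reg_l (2 * a)); try lra; field_simplify; lra.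
  - intro hk.
    apply (Rmult_eq_reg_l (4 * a)); [rewrite hfac, Rmult_0_r | lra].
    destruct hk as [-> | ->]; field; lra.
Qed.

Theorem theorem29 (l1 l2 l3 : R) (h1 : l1 > 0) (h2 : 0 > l2) (h3 : l2 >= l3) :
  let a := 3 * l1 * l2 * l3 in
  let b := 2 * (l1 * l2 + l1 * l3 + l2 * l3) in
  let c := l1 + l2 + l3 in
  let kminus := (- b - sqrt (b ^ 2 - 4 * a * c)) / (2 * a) in
  let kplus := (- b + sqrt (b ^ 2 - 4 * a * c)) / (2 * a) in
  (forall k : R,
     3 * l1 * l2 * l3 * k ^ 2 + 2 * (l1 * l2 + l1 * l3 + l2 * l3) * k
       + (l1 + l2 + l3) = 0
     <-> k = kminus \/ k = kplus) /\
  (- (1 / l1) < kminus < - (1 / l3)) /\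
  kplus >= - (1 / l3).
Proof.
  intros a b c kminus kplus.
  assert (h23 : 0 < l2 * l3) by nra.
  assert (h12 : l1 * l2 < 0) by nra.
  assert (h13 : l1 * l3 <= l1 * l2) by nra.
  assert (ha : 0 < a) by (unfold a; nra).
  assert (hD : 0 <= b ^ 2 - 4 * a * c).
  (* With [x], [y], [z] the pairwise products, [a * c = 3 * (x * y + y * z + z * x)], so the
     discriminant is twice the sum of the squared differences. *)
  { replace (b ^ 2 - 4 * a * c)
      with (2 * ((l1 * l2 - l1 * l3) ^ 2 + (l1 * l2 - l2 * l3) ^ 2
                 + (l1 * l3 - l2 * l3) ^ 2)) by (unfold a, b, c; ring).
    pose proof (pow2_ge_0 (l1 * l2 - l1 * l3)).
    pose proof (pow2_ge_0 (l1 * l2 - l2 * l3)).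
    pose proof (pow2_ge_0 (l1 * l3 - l2 * l3)).
    lra. }
  split; [intro k; exact (quadratic_roots a b c k ha hD) |].
  unfold kminus, kplus; clear kminus kplus.
  pose proof (pow2_sqrt _ hD) as hs.
  pose proof (sqrt_pos (b ^ 2 - 4 * a * c)) as hs0.
  set (s := sqrt (b ^ 2 - 4 * a * c)) in *.
  (* Over the denominator [2 * a] of the roots, only numerators remain to be compared. *)
  assert (ht1 : - (1 / l1) = - (6 * (l2 * l3)) / (2 * a))
    by (unfold a; field; repeat split; lra).
  assert (ht3 : - (1 / l3) = - (6 * (l1 * l2)) / (2 * a))
    by (unfold a; field; repeat split; lra).
  assert (hv : s ^ 2 = (6 * (l2 * l3) - b) ^ 2
                       - 12 * (l2 * l3) * ((l1 - l2) * (l1 - l3)))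
    by (rewrite hs; unfold a, b, c; ring).
  assert (hu : s ^ 2 = (6 * (l1 * l2) - b) ^ 2
                       + 12 * (- (l1 * l2)) * ((l1 - l3) * (l2 - l3)))
    by (rewrite hs; unfold a, b, c; ring).
  assert (hvs : s < 6 * (l2 * l3) - b).
  { assert (0 < (l1 - l2) * (l1 - l3)) by nra.
    assert (0 < 6 * (l2 * l3) - b) by (unfold b; lra).
    nra. }
  (* The two halves bound [kminus] and [kplus] respectively; only the first must be strict. *)
  assert (hus : 6 * (l1 * l2) - b < s /\ b - 6 * (l1 * l2) <= s).
  { destruct (Req_dec l2 l3) as [e | ne].
    (* Here the left side is [2 * l2 * (l1 - l2)], and [hu] reduces to an equality of squares, so
       [s = b - 6 * (l1 * l2)]. *)
    - assert (6 * (l1 * l2) - b < 0) by (unfold b; subst l3; nra).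
      rewrite e, Rminus_diag, !Rmult_0_r, Rplus_0_r, <- e in hu.
      split; nra.
    - assert (0 < (l1 - l3) * (l2 - l3)) by nra.
      assert ((6 * (l1 * l2) - b) ^ 2 < s ^ 2) by nra.
      split; nra. }
  assert (hinv : 0 < / (2 * a)) by (apply Rinv_0_lt_compat; lra).
  rewrite ht1, ht3; unfold Rdiv.
  repeat split.
  - apply Rmult_lt_compat_r; lra.
  - apply Rmult_lt_compat_r; lra.
  - apply Rmult_ge_compat_r; lra.
Qed.
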